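(* Let $f:\mathbb{R}\to\mathbb{R}$ be continuous and monotonic. Then $L_f^\infty$ is a $G_\delta$ set of Lebesgue measure zero. Conversely, if $E\subset\mathbb{R}$ is a $G_\delta$ set of Lebesgue measure zero, then there exists a continuous monotonic function $f:\mathbb{R}\to\mathbb{R}$ such that $L_f^\infty=E$ and $l_f^\infty=\emptyset$; moreover, $f$ can be chosen so that in addition $\operatorname{lip} f(x)=0$ for all $x\in E$.
   Context: For a continuous $f:\mathbb{R}\to\mathbb{R}$, $x\in\mathbb{R}$ and $r>0$, let $M_f(x,r)=\sup\{|f(x)-f(y)|/r : |x-y|\le r\}$. Define $\operatorname{Lip} f(x)=\limsup_{r\to0^+}M_f(x,r)$ and $\operatorname{lip} f(x)=\liminf_{r\to0^+}M_f(x,r)$ (values in $[0,\infty]$). Let $L_f^\infty=\{x\in\mathbb{R}:\operatorname{Lip} f(x)=\infty\}$ and $l_f^\infty=\{x\in\mathbb{R}:\operatorname{lip} f(x)=\infty\}$. *)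

(* Defs.v *)
From HB Require Import structures.
From mathcomp Require Import all_boot all_order all_algebra.
From mathcomp Require Import all_classical all_reals all_analysis borel_hierarchy.
Set Implicit Arguments. Unset Strict Implicit. Unset Printing Implicit Defensive.
Import Order.TTheory GRing.Theory Num.Theory.
Import numFieldNormedType.Exports.
Local Open Scope classical_set_scope.
Local Open Scope ring_scope.

Definition Mf {R : realType} (f : R -> R) (x r : R) : \bar R :=
  ereal_sup [set ((`|f x - f y| / r)%:E) | y in [set y | `|x - y| <= r]].

Definition Lipf {R : realType} (f : R -> R) (x : R) : \bar R :=
  limf_esup (Mf f x) (0 : R)^'+.

Definition lipf {R : realType} (f : R -> R) (x : R) : \bar R :=
  limf_einf (Mf f x) (0 : R)^'+.

Definition Linf {R : realType} (f : R -> R) : set R := [set x | Lipf f x = +oo%E].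
Definition linf {R : realType} (f : R -> R) : set R := [set x | lipf f x = +oo%E].

Definition monotone_fun {R : realType} (f : R -> R) : Prop :=
  {homo f : x y / x <= y} \/ {homo f : x y / x <= y >-> y <= x}.

(* Main.v *)
Require Import Defs.
From HB Require Import structures.
From mathcomp Require Import all_boot all_order all_algebra.
From mathcomp Require Import all_classical all_reals all_analysis borel_hierarchy measurable_realfun.
From mathcomp Require Import ring lra.
Set Implicit Arguments. Unset Strict Implicit. Unset Printing Implicit Defensive.
Import Order.TTheory GRing.Theory Num.Theory.
Import numFieldNormedType.Exports.
Local Open Scope classical_set_scope.
Local Open Scope ring_scope.

(* If f is continuous and nondecreasing, every x with Lip f(x) = +oo is the
   centre of small balls over which f increases by at least n times the radius;
   by Vitali's covering lemma such points of a bounded interval form a set of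
   measure O(1/n).

   Conversely, choose open sets V 0, V 1, ... decreasing to E such that, seen from
   any point outside V k, the set V k.+1 has tiny relative measure at every
   scale, and let f be the primitive of the density equal to m on
   V (2m) \ V (2m+1) and to 0 elsewhere.  For x in E, let a be the nearest point
   outside V k, at distance r.  If k = 2m, the density is m on most of [a, x], so
   f is steep there; if k = 2m+1, the density vanishes on most of
   [x - r, x + r], so f is almost flat at scale r.  A point outside some V k sees
   only bounded densities and thin later layers, so Lip f is finite there. *)

(** * Lipschitz numbers: tests by difference quotients and by small radii *)

Section LipschitzNumbers.
Context {R : realType}.
Implicit Types (f : R -> R) (x y r : R).

Lemma Mf_ge f x y r : `|x - y| <= r -> ((`|f x - f y| / r)%:E <= Mf f x r)%E.
Proof. by move=> xyr; apply: ereal_sup_ubound; exists y. Qed.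

Lemma Mf_le f x r (c : \bar R) :
  (forall y, `|x - y| <= r -> ((`|f x - f y| / r)%:E <= c)%E) ->
  (Mf f x r <= c)%E.
Proof. by move=> h; apply: ge_ereal_sup => _ /= [y xyr <-]; exact: h. Qed.

(** A quotient exceeding [n] with denominator [r] only grows when [r] shrinks to [|x - y|], so the
    limsup over radii can be tested on difference quotients at single points. *)
Lemma LinfP f x : Linf f x <->
  forall n : nat, exists2 y, `|x - y| < n.+1%:R^-1 &
    n%:R * `|x - y| < `|f x - f y|.
Proof.
rewrite /Linf/= /Lipf limf_esupE; split=> [Lx n|h].
  pose A : set R := [set r | 0 < r /\ r < n.+1%:R^-1].
  have /ereal_inf_pinfty := Lx => /(_ (ereal_sup (Mf f x @` A))) supA.
  have : (n%:R%:E < ereal_sup (Mf f x @` A))%E.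
    rewrite supA ?ltry//; exists A => //.
    near=> r; split; first by near: r; exact: nbhs_right_gt.
    by near: r; apply: nbhs_right_lt; rewrite invr_gt0.
  move=> /ereal_sup_gt[_ [r [r0 rn] <-]] /ereal_sup_gt[_ [y /= xyr <-]].
  rewrite lte_fin ltr_pdivlMr// => nr; exists y; first exact: le_lt_trans rn.
  by apply: le_lt_trans nr; rewrite ler_wpM2l.
apply/ereal_inf_pinfty => _ [A A0 <-] /=.
apply: eq_infty => M.
have [e/= e0 eA] := A0.
(* The first index makes the slope exceed [M], the second puts [|x - y|] inside the given
   neighbourhood of 0. *)
pose n := maxn (Num.trunc M).+1 (Num.trunc e^-1).+1.
have [y xyn nxy] := h n.
have xy0 : 0 < `|x - y|.
  rewrite lt_neqAle normr_ge0 andbT eq_sym; apply/eqP => xy0.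
  by move: nxy; rewrite xy0 mulr0; move/normr0_eq0/subr0_eq : xy0 => <-;
     rewrite subrr normr0 ltxx.
apply: (@le_trans _ _ (Mf f x `|x - y|)); last first.
  apply: ereal_sup_ubound; exists `|x - y| => //; apply: eA => //=.
  rewrite sub0r normrN normr_id (lt_trans xyn)//.
  rewrite invf_plt ?posrE// (lt_le_trans (truncnS_gt _))// ler_nat.
  by rewrite (leq_trans _ (leqnSn _))// leq_maxr.
apply: le_trans (@Mf_ge f x y _ (lexx _)).
rewrite lee_fin ler_pdivlMr// (le_trans _ (ltW nxy))// ler_wpM2r//.
by rewrite (le_trans (ltW (truncnS_gt _)))// ler_nat leq_maxl.
Unshelve. all: by end_near. Qed.

Lemma lipf_ge0 f x : (0 <= lipf f x)%E.
Proof.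
rewrite /lipf limf_einfE.
apply: ereal_sup_ge; exists (ereal_inf (Mf f x @` [set r | 0 < r])).
  by exists [set r : R | 0 < r] => //; exact: nbhs_right_gt.
apply: le_ereal_inf_tmp => _ [r /= r0 <-].
apply: (le_trans _ (@Mf_ge f x x r _)); last by rewrite subrr normr0 ltW.
by rewrite subrr normr0 mul0r.
Qed.

Lemma lipf_le f x (c : \bar R) :
  (forall e, 0 < e -> exists r, [/\ 0 < r, r < e & (Mf f x r <= c)%E]) ->
  (lipf f x <= c)%E.
Proof.
move=> h; rewrite /lipf limf_einfE; apply: ge_ereal_sup => _ [A [e /= e0 eA] <-].
have [r [r0 re rc]] := h _ e0.
apply: ereal_inf_le; exists (Mf f x r) => //; exists r => //; apply: eA => //=.
by rewrite sub0r normrN gtr0_norm.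
Qed.

Lemma lipf_le_Lipf f x : (lipf f x <= Lipf f x)%E.
Proof.
rewrite /lipf /Lipf limf_einfE limf_esupE.
apply: ge_ereal_sup => _ [A FA <-]; apply: le_ereal_inf_tmp => _ [B FB <-].
have [r [Ar Br]] := filter_ex (filterI FA FB).
apply: (@le_trans _ _ (Mf f x r)).
  by apply: ereal_inf_lbound; exists r.
by apply: ereal_sup_ubound; exists r.
Qed.

(** For each fixed [y] both strict inequalities of [LinfP] are open conditions on [x]; take the
    union over [y], then the intersection over [n]. *)
Lemma Gdelta_Linf f : continuous f -> Gdelta (Linf f).
Proof.
move=> cf.
exists (fun n => \bigcup_(y : R)
  [set x | `|x - y| < n.+1%:R^-1 /\ 0 < `|f x - f y| - n%:R * `|x - y|]).
  move=> n; apply: bigcup_open => y _.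
  have cu : continuous (fun x : R => `|x - y|).
    by move=> x; apply: cvg_norm; apply: cvgB; [exact: cvg_id|exact: cvg_cst].
  have cv : continuous (fun x => `|f x - f y| - n%:R * `|x - y|).
    move=> x; apply: cvgB; last by apply: cvgMl_tmp; exact: cu.
    by apply: cvg_norm; apply: cvgB; [exact: cf|exact: cvg_cst].
  apply: openI.
    exact: (open_comp (fun x _ => cu x) (@open_lt R n.+1%:R^-1)).
  exact: (open_comp (fun x _ => cv x) (@open_gt R 0)).
apply/seteqP; split=> [x /LinfP h n _|x h].
  by have [y xy nxy] := h n; exists y => //=; rewrite subr_gt0.
by apply/LinfP => n; have [y _ [xy]] := h n I; rewrite subr_gt0; exists y.
Qed.

End LipschitzNumbers.

(** * Covering estimate for the steep points of a nondecreasing function *)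

Section MonotoneNull.
Context {R : realType}.
Notation lambda := (@lebesgue_measure R).

Lemma stieltjes_itvoc (g : cumulative R R) (a b : R) : a <= b ->
  lebesgue_stieltjes_measure g `]a, b] = (g b - g a)%:E.
Proof.
move=> ab; rewrite /lebesgue_stieltjes_measure /measure_extension/=.
rewrite measurable_mu_extE; last exact: is_ocitv.
exact: wlength_itv_bnd.
Qed.

(** Additivity and monotonicity of the Stieltjes measure of [f] spare ordering the disjoint
    intervals by position. *)
Lemma sum_increments_le (f : R -> R) (a b : R) (I : choiceType) (s : seq I)
    (c d : I -> R) :
  continuous f -> {homo f : x y / x <= y} -> a <= b -> uniq s ->
  trivIset [set` s] (fun i => `]c i, d i]%classic) ->
  (forall i, i \in s -> c i <= d i /\ `]c i, d i] `<=` `]a, b]) ->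
  \sum_(i <- s) (f (d i) - f (c i)) <= f b - f a.
Proof.
move=> cf ndf ab us ts sab.
pose iscumf := isCumulative.Build R _ R f ndf (right_continuousW cf).
pose g : cumulative R R := HB.pack f iscumf.
have ms i : [set` s] i ->
    measurable (`]c i, d i]%classic : set (g_sigma_algebraType (R.-ocitv.-measurable))).
  by move=> _; apply: sub_sigma_algebra; exact: is_ocitv.
rewrite -lee_fin -(stieltjes_itvoc g ab).
apply: (@le_trans _ _ (lebesgue_stieltjes_measure g
    (\bigcup_(i in [set` s]) `]c i, d i]%classic))); last first.
  apply: le_measure; rewrite ?inE.
  - by apply: fin_bigcup_measurable.
  - by apply: sub_sigma_algebra; exact: is_ocitv.
  - by apply: bigcup_sub => i /sab[].
rewrite measure_fin_bigcup// -fsbig_seq//.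
rewrite -sumEFin big_seq [leRHS]big_seq; apply: lee_sum => i /sab[cd _].
by have := stieltjes_itvoc g cd => /= ->.
Qed.

(* 12 = 3 * 2 * 2: the Vitali enlargement, the balls of radius 2r over
   increments of half-width r, and diameter over radius. *)
Lemma compact_steep_measure (f : R -> R) (a b c : R) (K : set R) :
  continuous f -> {homo f : x y / x <= y} -> a <= b -> 0 < c -> compact K ->
  (forall x, K x -> exists r, [/\ 0 < r, ball x (r *+ 2) `<=` `]a, b] &
     c * r <= f (x + r) - f (x - r)]) ->
  (lambda K <= (12 / c * (f b - f a))%:E)%E.
Proof.
move=> cf ndf ab c0 cK Kr.
have /choice[r Pr] : forall x, exists r, 0 < r /\ (K x ->
    ball x (r *+ 2) `<=` `]a, b] /\ c * r <= f (x + r) - f (x - r)).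
  (* Outside [K] the dummy radius 1 keeps every [B x] a nonempty open ball. *)
  move=> x; have [Kx|nKx] := pselect (K x); last by exists 1.
  by have [r [r0 xr xc]] := Kr _ Kx; exists r.
have r0 x : 0 < r x by have [] := Pr x.
(* With doubled radius the open balls contain []x - r x, x + r x]], right endpoint included, so
   disjoint balls give disjoint intervals. *)
pose B x : set R := ball x (r x *+ 2).
have [D Dsub Kcover] : finite_subset_cover K B K.
  move: (cK); rewrite compact_cover; apply.
    by move=> x Kx; exact: ball_open.
  by move=> x Kx; exists x => //; apply: ballxx; rewrite pmulrn_lgt0.
have is_ballB i : is_ball (B i) by exact: is_ball_ball.
have Bset0 i : B i !=set0 by exists i; apply: ballxx; rewrite pmulrn_lgt0.
have [E [uE ED tEB DE]] := @vitali_lemma_finite_cover _ _ B is_ballB Bset0 (finmap.enum_fset D).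
have EK x : x \in E -> K x by move=> /ED/Dsub; rewrite inE.
have sub x : `](x - r x), (x + r x)] `<=` B x.
  move=> z; rewrite /B ball_itv/= !in_itv/= => /andP[h1 h2].
  by have rx := r0 x; apply/andP; split; lra.
have fsum : \sum_(x <- E) (f (x + r x) - f (x - r x)) <= f b - f a.
  apply: sum_increments_le => //.
    move=> i j iE jE [z [zi zj]]; apply: tEB => //.
    by exists z; split; exact: sub.
  move=> x xE; split; first by have := r0 x; lra.
  by apply: subset_trans (sub x) _; have [_ []] := Pr x; first exact: EK.
apply: (@le_trans _ _ (\sum_(x <- E) (12 * r x)%:E)%E); last first.
  rewrite sumEFin lee_fin -mulr_sumr -mulrA ler_wpM2l//.
  rewrite ler_pdivlMl// mulr_sumr (le_trans _ fsum)//.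
  rewrite big_seq [leRHS]big_seq; apply: ler_sum => x xE.
  by have [_ []] := Pr x; first exact: EK.
have KE : K `<=` cover [set` E] (scale_ball 3%:R \o B).
  apply: subset_trans DE; apply: (subset_trans Kcover) => x [i iD xi].
  by exists i.
apply: (le_trans (@content_subadditive _ _ _ lambda K
    (fun i => scale_ball 3 (B (nth 0%R E i))) (size E) _ _ _)) => //.
- by move=> k ?; rewrite scale_ballE//; exact: measurable_ball.
- by apply: closed_measurable; apply: compact_closed => //; exact: Rhausdorff.
- apply: (subset_trans KE); rewrite /cover bigcup_seq.
  by rewrite (big_nth 0%R)//= big_mkord.
- rewrite (big_nth 0%R) big_mkord; apply: lee_sum => i _.
  set x := nth 0 E i.
  have rx : 0 <= 3 * (r x *+ 2) by rewrite mulr_ge0// mulrn_wge0// ltW.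
  rewrite scale_ballE//.
  have := lebesgue_measure_ball x rx => /= ->.
  by rewrite lee_fin; lra.
Qed.

End MonotoneNull.

(** * Nullity of [Linf] for continuous monotone functions *)

Section NullLinf.
Context {R : realType}.
Notation lambda := (@lebesgue_measure R).

(** On a bounded interval inner regularity reduces the claim to compact sets, where the covering
    estimate with a large slope [m] gives a bound below any prescribed [e]. *)
Lemma continuous_nondecreasing_null_Linf (f : R -> R) :
  continuous f -> {homo f : x y / x <= y} -> lambda (Linf f) = 0%E.
Proof.
move=> cf ndf.
have mL : measurable (Linf f) by apply: Gdelta_measurable; exact: Gdelta_Linf.
pose J n : set R := `](- n%:R), n%:R[%classic.
have mLJ n : measurable (Linf f `&` J n).
  by apply: measurableI => //; exact: measurable_itv.
suff LJ0 n : lambda (Linf f `&` J n) = 0%E.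
  apply: measure_negligible => //.
  have -> : Linf f = \bigcup_n (Linf f `&` J n).
    by rewrite -setI_bigcupr bigcup_itvT setIT.
  apply: negligible_bigcup => n.
  by exists (Linf f `&` J n); split; [exact: mLJ|exact: LJ0|].
set b : R := n%:R.
have nb : - b <= b by rewrite -subr_ge0 opprK addr_ge0.
apply/eqP; rewrite eq_le measure_ge0 andbT lebesgue_regularity_inner_sup//.
apply: ge_ereal_sup => _ [K [cK KL] <-].
apply/lee_addgt0Pr => e e0; rewrite add0e.
have D0 : 0 <= f b - f (- b) by rewrite subr_ge0 ndf.
pose m := (Num.trunc (12 * (f b - f (- b)) / e)).+1.
have m0 : 0 < m%:R :> R by [].
apply: le_trans (compact_steep_measure cf ndf nb m0 cK _) _; last first.
  rewrite lee_fin mulrAC ler_pdivrMr// -ler_pdivrMl// mulrC.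
  exact/ltW/truncnS_gt.
move=> x /KL[/LinfP Lx]; rewrite /J/= in_itv/= => /andP[bx xb].
pose d := Num.min (x + b) (b - x).
have d0 : 0 < d by rewrite lt_min; apply/andP; split; lra.
(* The first index gives slope at least [m]; the second keeps the ball of radius [2 * r] inside the
   interval. *)
have [y xy mxy] := Lx (maxn m (Num.trunc (2 / d)).+1).
pose r := `|x - y|; exists r.
have r0 : 0 < r.
  rewrite /r lt_neqAle normr_ge0 andbT eq_sym; apply/eqP => xy0.
  by move: mxy; rewrite xy0 mulr0; move/normr0_eq0/subr0_eq : xy0 => <-;
     rewrite subrr normr0 ltxx.
split => //.
  have rd : r *+ 2 < d.
    rewrite -mulr_natl -ltr_pdivlMl// (lt_le_trans xy)//.
    rewrite -[leRHS]invrK lef_pV2 ?posrE ?invr_gt0 ?mulr_gt0 ?invr_gt0//.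
    rewrite invfM invrK (le_trans (ltW (truncnS_gt _)))// ler_nat.
    by rewrite (leq_trans _ (leqnSn _))// leq_maxr.
  move: rd; rewrite lt_min => /andP[rd1 rd2].
  move=> z; rewrite ball_itv/= !in_itv/= => /andP[h1 h2].
  by apply/andP; split; lra.
apply: (@le_trans _ _ ((maxn m (Num.trunc (2 / d)).+1)%:R * r)).
  by rewrite ler_wpM2r ?ler_nat ?leq_maxl// ltW.
apply: (le_trans (ltW mxy)).
(* Whichever side [y] lies on, monotonicity bounds [|f x - f y|] by the increase over
   [[x - r, x + r]]. *)
have [xley|ylex] := leP x y.
  rewrite distrC ger0_norm ?subr_ge0 ?ndf// /r distrC ger0_norm ?subr_ge0//.
  by apply: lerB; apply: ndf; lra.
have := ltW ylex => ylex'.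
rewrite ger0_norm ?subr_ge0 ?ndf// /r ger0_norm ?subr_ge0//.
by apply: lerB; apply: ndf; lra.
Qed.

Lemma LinfN (f : R -> R) : Linf (fun x => - f x) = Linf f.
Proof.
suff M x : Mf (fun x => - f x) x = Mf f x.
  by apply/seteqP; split => x; rewrite /Linf /= /Lipf M.
apply/funext => r; congr ereal_sup.
by apply/seteqP; split => _ [y xy <-]; exists y => //; rewrite -opprD normrN.
Qed.

Lemma continuous_monotone_null_Linf (f : R -> R) :
  continuous f -> monotone_fun f -> lambda (Linf f) = 0%E.
Proof.
move=> cf [ndf|nif]; first exact: continuous_nondecreasing_null_Linf.
rewrite -LinfN; apply: continuous_nondecreasing_null_Linf.
  by move=> x; apply: cvgN; exact: cf.
by move=> x y xy; rewrite lerN2; exact: nif.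
Qed.

End NullLinf.

(** * Open neighbourhoods of a null set that look thin from outside *)

Section ThinNeighbourhoods.
Context {R : realType}.
Notation lambda := (@lebesgue_measure R).

Lemma measure_bigcup_le_geometric (W : nat -> set R) (e : R) : 0 <= e ->
  (forall j, measurable (W j)) ->
  (forall j, (lambda (W j) <= (e / (2 ^ j.+1)%:R)%:E)%E) ->
  (lambda (\bigcup_j W j) <= e%:E)%E.
Proof.
move=> e0 mW We.
apply: (@le_trans _ _ (\sum_(0 <= j <oo) lambda (W j))%E).
  apply: measure_sigma_subadditive => //.
  exact: bigcupT_measurable.
apply: (@le_trans _ _ (\sum_(0 <= j <oo) (0 + (e / (2 ^ j.+1)%:R)%:E))%E).
  by apply: lee_nneseries => // j _; rewrite add0e.
apply: (le_trans (epsilon_trick xpredT (A := fun=> 0%E) _ e0)) => //.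
by rewrite eseries0// add0e.
Qed.

Lemma null_outer_open (A : set R) (e : R) : measurable A -> lambda A = 0%E ->
  0 < e -> exists U, [/\ open U, A `<=` U & (lambda U <= e%:E)%E].
Proof.
move=> mA A0 e0.
have Aoo : (lambda A < +oo)%E by rewrite A0 ltry.
have [U [oU AU UAe]] := lebesgue_regularity_outer mA Aoo e0.
have mU : measurable U by exact: open_measurable.
exists U; split => //.
have -> : U = (U `\` A) `|` A by rewrite setUC setDUK.
have mUA : measurable (U `\` A) by exact: measurableD.
have := measureU2 lambda mUA mA; move=> /le_trans; apply.
by rewrite [X in (_ + X)%E](_ : _ = 0%E)// adde0; exact: ltW.
Qed.

(** Sort the points of [V] by depth: those in [F j] are more than [2^-j] away from the complement.
    Cover the part of [E] in [F j] by an open set of measure at most [e * 2^-j * 2^-(j+1)]. A window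
    of half-width [d] about a point outside [V] meets [F j] only if [2^-j < d], so the pieces it
    meets add up to at most [e * d]. *)
Lemma thin_neighbourhood (E U V : set R) (e : R) : measurable E ->
  lambda E = 0%E -> open U -> open V -> E `<=` U -> E `<=` V -> 0 < e ->
  exists W : set R, [/\ open W, E `<=` W, W `<=` U `&` V,
    (lambda W <= e%:E)%E &
    forall x d : R, ~ V x -> 0 < d ->
      (lambda (W `&` `[(x - d)%R, (x + d)%R]) <= (e * d)%:E)%E].
Proof.
move=> mE E0 oU oV EU EV e0.
pose F j := [set x | exists2 r : R, (2 ^ j)%:R^-1 < r & ball x r `<=` V].
have oF j : open (F j).
  rewrite openE => x [r jr rV] /=.
  pose s := (r - (2 ^ j)%:R^-1) / 2.
  have s0 : 0 < s by rewrite divr_gt0// subr_gt0.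
  apply/nbhs_ballP; exists s => // y xy; exists (r - s).
    by rewrite /s; lra.
  move=> z yz; apply: rV; rewrite -(subrKC s r).
  exact: ball_triangle xy yz.
have VF x : V x -> exists j, F j x.
  move=> /(open_subball oV)[s /= s0 sV].
  pose r := s / 2; have r0 : 0 < r by rewrite divr_gt0.
  exists (Num.trunc r^-1).+1, r.
    rewrite invf_plt ?posrE ?ltr0n ?expn_gt0//.
    by rewrite (lt_trans (truncnS_gt _))// ltr_nat ltn_expl.
  by apply: sV => //=; rewrite sub0r normrN gtr0_norm// /r; lra.
have /choice[G PG] : forall j, exists O : set R, [/\ open O, E `&` F j `<=` O &
    (lambda O <= (e / (2 ^ j)%:R / (2 ^ j.+1)%:R)%:E)%E].
  move=> j; apply: null_outer_open.
  - by apply: measurableI => //; exact: open_measurable.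
  - apply/eqP; rewrite eq_le measure_ge0 andbT -E0 le_measure ?inE//.
    by apply: measurableI => //; exact: open_measurable.
  - by rewrite !divr_gt0// ltr0n expn_gt0.
(* Intersecting with [F j] keeps all of [W j], not just [E], at depth [2^-j], as the window estimate
   requires. *)
pose W j := G j `&` F j `&` U.
have oW j : open (W j).
  by apply: openI => //; apply: openI => //; have [] := PG j.
have mW j : measurable (W j) by exact: open_measurable.
have lW j : (lambda (W j) <= (e / (2 ^ j)%:R / (2 ^ j.+1)%:R)%:E)%E.
  have [oO _ lO] := PG j; apply: (le_trans _ lO); apply: le_measure.
  - by rewrite inE; exact: mW.
  - by rewrite inE; exact: open_measurable.
  - by move=> x [[]].
have two0 j : 0 < (2 ^ j)%:R :> R by rewrite ltr0n expn_gt0.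
exists (\bigcup_j W j); split.
- exact: bigcup_open.
- move=> x Ex; have [j Fx] := VF _ (EV _ Ex); exists j => //.
  by split; [split => //; have [_ + _] := PG j; apply|exact: EU].
- move=> x [j _ [[_ [r jr rV]] Ux]]; split => //; apply: rV.
  by apply: ballxx; rewrite (lt_trans _ jr)// invr_gt0.
- apply: measure_bigcup_le_geometric; [exact: ltW|exact: mW|move=> j].
  rewrite (le_trans (lW j))// lee_fin ler_pM2r ?invr_gt0//.
  by rewrite ler_pdivrMr// ler_peMr ?(ltW e0)// ler1n expn_gt0.
- move=> x d Vx d0; rewrite setI_bigcupl.
  apply: measure_bigcup_le_geometric; first by rewrite mulr_ge0// ltW.
    by move=> j; apply: measurableI; [exact: mW|exact: measurable_itv].
  move=> j; have [->|/set0P[z [[[_ [r jr rV]] _]]]] :=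
      eqVneq (W j `&` `[(x - d), (x + d)]) set0.
    by rewrite measure0 lee_fin divr_ge0// mulr_ge0// ltW.
  rewrite /= in_itv/= => /andP[z1 z2].
  have rd : r <= d.
    rewrite leNgt; apply/negP => dr; apply: Vx; apply: rV.
    by rewrite ball_itv/= in_itv/=; apply/andP; split; lra.
  apply: (@le_trans _ _ (lambda (W j))).
    apply: le_measure; rewrite ?inE.
    - by apply: measurableI; [exact: mW|exact: measurable_itv].
    - exact: mW.
    - exact: subIsetl.
  rewrite (le_trans (lW j))// lee_fin ler_pM2r ?invr_gt0//.
  by rewrite ler_pM2l// (le_trans _ rd)// ltW.
Qed.

(** The radius is the supremum of those of balls about [x] inside [V], bounded because [V] has
    finite measure. It is attained, and [x - r] or [x + r] lies outside [V]: otherwise openness at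
    both ends would allow a larger ball. *)
Lemma exists_nearest_outside (V : set R) (c x : R) : open V ->
  (lambda V <= c%:E)%E -> V x ->
  exists r a, [/\ 0 < r, r *+ 2 <= c, ball x r `<=` V, ~ V a & `|x - a| = r].
Proof.
move=> oV Vc Vx.
pose S := [set r : R | 0 < r /\ ball x r `<=` V].
have S0 : S !=set0.
  have [s /= s0 sV] := open_subball oV Vx; exists (s / 2); split.
    by rewrite divr_gt0.
  by apply: sV => /=; rewrite ?divr_gt0// sub0r normrN gtr0_norm ?divr_gt0//; lra.
have Sc r : S r -> r *+ 2 <= c.
  move=> [r0 rV]; rewrite -lee_fin -(lebesgue_measure_ball x (ltW r0)).
  apply: (le_trans _ Vc); apply: le_measure; rewrite ?inE//.
    exact: measurable_ball.
  exact: open_measurable.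
have hS : has_sup S by split => //; exists (c / 2) => r /Sc; lra.
pose r := sup S.
have r0 : 0 < r.
  have [s Ss] := S0; have [s0 _] := Ss.
  by apply: (lt_le_trans s0); apply: ub_le_sup => //; exact: hS.2.
have rV : ball x r `<=` V.
  move=> y xy; have [s [s0 sV] xys] := sup_gt S0 xy.
  exact: sV.
have [a [Va xa]] : exists a, ~ V a /\ `|x - a| = r.
  have [V1|] := pselect (V (x - r)); last first.
    by move=> ?; exists (x - r); split => //; rewrite opprB addrC subrK gtr0_norm.
  have [V2|] := pselect (V (x + r)); last first.
    move=> ?; exists (x + r); split => //.
    by rewrite opprD addNKr normrN gtr0_norm.
  exfalso.
  have [s1 /= s10 s1V] := open_subball oV V1.
  have [s2 /= s20 s2V] := open_subball oV V2.
  pose s := Num.min s1 s2 / 2.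
  have s0 : 0 < s by rewrite divr_gt0// lt_min s10.
  have [ss1 ss2] : s < s1 /\ s < s2.
    have : Num.min s1 s2 <= s1 by rewrite ge_min lexx.
    have : Num.min s1 s2 <= s2 by rewrite ge_min lexx orbT.
    by move: s0; rewrite /s; split; lra.
  have : S (r + s).
    split; first exact: addr_gt0.
    move=> y; rewrite ball_itv/= in_itv/= => /andP[xy1 xy2].
    have [yx|xy] := leP y (x - r).
      apply: (s1V s) => //=; first by rewrite sub0r normrN gtr0_norm.
      by rewrite ball_itv/= in_itv/=; apply/andP; split; lra.
    have [yx'|xy'] := leP (x + r) y.
      apply: (s2V s) => //=; first by rewrite sub0r normrN gtr0_norm.
      by rewrite ball_itv/= in_itv/=; apply/andP; split; lra.
    by apply: rV; rewrite ball_itv/= in_itv/=; apply/andP; split.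
  move/(ub_le_sup hS.2); rewrite -/r; lra.
exists r, a; split => //.
suff : r <= c / 2 by lra.
by apply: ge_sup => // s /Sc; lra.
Qed.

End ThinNeighbourhoods.

(** * Decreasing towers of open sets around a null Gdelta set *)

Section ThinTower.
Context {R : realType}.
Notation lambda := (@lebesgue_measure R).

(** The absolute bound [2^-k] yields finite mass, continuity and short distances to the complement;
    the relative bound, at every scale [d], yields the slope estimates. *)
Definition thin_tower (E : set R) (V : nat -> set R) : Prop :=
  [/\ forall k, open (V k), E = \bigcap_k V k, forall k, V k.+1 `<=` V k,
    forall k, (lambda (V k) <= (2 ^- k)%:E)%E &
    forall k (x d : R), ~ V k x -> 0 < d ->
      (lambda (V k.+1 `&` `[(x - d)%R, (x + d)%R]) <= (2 ^- k.+1 * d)%:E)%E].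

(** Iterate [thin_neighbourhood], keeping [V k] inside the [k]-th open set [U k] of a Gdelta
    presentation so that the intersection is exactly [E]. *)
Lemma exists_thin_tower (E : set R) : Gdelta E -> lambda E = 0%E ->
  exists V, thin_tower E V.
Proof.
move=> GE E0; have mE := Gdelta_measurable GE; have [U oU EU] := GE.
have EUk k : E `<=` U k by rewrite EU; exact: bigcap_inf.
have p2 k : 0 < 2 ^- k :> R by rewrite invr_gt0 exprn_gt0.
have /choice[step Pstep] : forall kV : nat * set R, exists W : set R,
    open kV.2 -> E `<=` kV.2 ->
    [/\ open W, E `<=` W, W `<=` U kV.1 `&` kV.2,
    (lambda W <= (2 ^- kV.1)%:E)%E &
    forall x d : R, ~ kV.2 x -> 0 < d ->
      (lambda (W `&` `[(x - d)%R, (x + d)%R]) <= (2 ^- kV.1 * d)%:E)%E].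
  move=> [k V] /=; have [[oV EV]|h] := pselect (open V /\ E `<=` V); last first.
    (* A pair violating the side conditions gets an arbitrary value, so [step] is total and the
       recursion carries no proofs. *)
    by exists V => oV EV; exfalso; exact: h.
  have [W PW] := thin_neighbourhood mE E0 (oU k) oV (EUk k) EV (p2 k).
  by exists W.
pose V := fix V k := if k is k'.+1 then step (k, V k') else step (0%N, setT).
have PV k : open (V k) /\ E `<=` V k.
  elim: k => [|k [oVk EVk]].
    by have [] := Pstep (0%N, setT) openT (@subsetT _ _).
  by have [] := Pstep (k.+1, V k) oVk EVk.
have PVS k := Pstep (k.+1, V k) (PV k).1 (PV k).2.
have VU k : V k `<=` U k.
  case: k => [|k].
    by have [_ _ + _ _] := Pstep (0%N, setT) openT (@subsetT _ _) => /[swap] x /[apply] -[].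
  by have [_ _ + _ _] := PVS k => /[swap] x /[apply] -[].
exists V; split.
- by move=> k; have [] := PV k.
- apply/seteqP; split => [x Ex k _|x Vx]; first exact: (PV k).2.
  by rewrite EU => k _; apply: VU; exact: Vx.
- by move=> k; have [_ _ + _ _] := PVS k => /[swap] x /[apply] -[].
- case=> [|k]; first by have [] := Pstep (0%N, setT) openT (@subsetT _ _).
  by have [] := PVS k.
- by move=> k; have [] := PVS k.
Qed.

End ThinTower.

(** * The primitive of the layered density and its Lipschitz numbers *)

Section TowerFunction.
Context {R : realType} (E : set R) (V : nat -> set R) (VE : thin_tower E V).
Notation lambda := (@lebesgue_measure R).

Definition tower_layer m := V m.*2 `\` V m.*2.+1.

(** The integral over [B] of the density equal to [m] on layer [m], written as a series of
    measures. *)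
Definition tower_mass (B : set R) : \bar R :=
  (\sum_(0 <= m <oo) m%:R%:E * lambda (tower_layer m `&` B))%E.

(** The total mass is finite for a thin tower, so [fine] loses nothing there. *)
Definition tower_fun (x : R) : R := fine (tower_mass `]-oo, x[).

Let A := tower_layer.
Let mu := tower_mass.
Let f := tower_fun.

Let oV k : open (V k). Proof. by have [] := VE. Qed.

Let mV k : measurable (V k). Proof. exact: open_measurable. Qed.

Let mA m : measurable (A m). Proof. exact: measurableD. Qed.

Let V_le j k : (j <= k)%N -> V k `<=` V j.
Proof.
move=> /subnK <-; elim: (k - j)%N => [//|i IH].
by rewrite addSn; apply: subset_trans IH; have [_ _ + _ _] := VE; apply.
Qed.

Let EV x : E x <-> forall k, V k x.
Proof.
have [_ -> _ _ _] := VE.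
by split => [h k|h k _]; [exact: h|exact: h].
Qed.

Let pow2_gt0 (k : nat) : 0 < 2 ^+ k :> R. Proof. exact: exprn_gt0. Qed.

Let lambda_mono (B C : set R) : measurable B -> measurable C -> B `<=` C ->
  (lambda B <= lambda C)%E.
Proof. by move=> mB mC BC; apply: le_measure; rewrite ?inE. Qed.

Let term_ge0 (B : set R) m : (0 <= m%:R%:E * lambda (A m `&` B))%E.
Proof. by rewrite mule_ge0// lee_fin. Qed.

Let mu_ge0 (B : set R) : (0 <= mu B)%E.
Proof. exact: nneseries_ge0. Qed.

(** Split the series at [N]. The first [N] terms have weight at most [N] and measure at most [d]; in
    the tail [m <= 2^m] bounds each term by [2^-m * c], a geometric series with sum
    [2 * c / 2^N]. *)
Let mu_le (B : set R) (N : nat) (c d : R) : 0 <= c -> 0 <= d ->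
  (forall m, (m < N)%N -> (lambda (A m `&` B) <= d%:E)%E) ->
  (forall m, (N <= m)%N -> (lambda (A m `&` B) <= (2 ^- m.*2 * c)%:E)%E) ->
  (mu B <= (N%:R ^+ 2 * d + 2 * c / 2 ^+ N)%:E)%E.
Proof.
move=> c0 d0 hd hc.
rewrite /mu /tower_mass (nneseries_split 0 N)// add0n EFinD; apply: leeD.
  apply: (@le_trans _ _ (\sum_(0 <= k < N) (N%:R * d)%:E)%E).
    rewrite [leLHS]big_nat [leRHS]big_nat; apply: lee_sum => m /andP[_ mN].
    rewrite EFinM lee_pmul// ?lee_fin ?ler_nat//; first exact: ltnW.
    exact: hd.
  by rewrite sumEFin lee_fin sumr_const_nat subn0 -[leLHS]mulr_natl expr2 mulrA.
rewrite -[N in leLHS]add0n -nneseries_addn//.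
apply: (@le_trans _ _ (\sum_(0 <= k <oo) (2 * c / (2 ^ (k + N.+1))%:R)%:E)%E).
  apply: lee_nneseries => // k _.
  have hk := hc (k + N)%N (leq_addl _ _).
  apply: (@le_trans _ _ ((2 ^ (k + N))%:R%:E * (2 ^- (k + N).*2 * c)%:E)%E).
    by rewrite lee_pmul// ?lee_fin ?ler_nat// ltnW// ltn_expl.
  rewrite -EFinM lee_fin addnS expnS natrM !natrX; move: (k + N)%N => i.
  rewrite -addnn exprD le_eqVlt; apply/orP; left; apply/eqP; field.
  by rewrite expf_neq0// pnatr_eq0.
rewrite (_ : (\sum_(0 <= k <oo) _)%E = (2 * c / 2 ^+ N)%:E)//.
exact/cvg_lim/cvg_geometric_eseries_half.
Qed.

Let lambda_layer_le m (B : set R) : measurable B ->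
  (lambda (A m `&` B) <= (2 ^- m.*2)%:E)%E.
Proof.
move=> mB; have [_ _ _ + _] := VE => /(_ m.*2); apply: le_trans.
by apply: lambda_mono => //; [exact: measurableI|move=> x [[]]].
Qed.

Let mu_fin (B : set R) : measurable B -> mu B \is a fin_num.
Proof.
move=> mB; rewrite ge0_fin_numE//; apply: le_lt_trans (ltry _).
apply: (@mu_le B 0 1 0) => // m _; rewrite mulr1; exact: lambda_layer_le.
Qed.

Let muU (B C : set R) : measurable B -> measurable C -> B `&` C = set0 ->
  mu (B `|` C) = (mu B + mu C)%E.
Proof.
move=> mB mC BC; rewrite /mu /tower_mass -nneseriesD//.
apply: eq_eseriesr => m _; have mAm := mA m.
have -> : lambda (A m `&` (B `|` C)) =
    (lambda (A m `&` B) + lambda (A m `&` C))%E.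
  rewrite setIUr measureU//; try exact: measurableI.
  by rewrite setIACA BC setI0.
by rewrite ge0_muleDr.
Qed.

Let f_sub x y : x <= y -> f y - f x = fine (mu `[x, y[).
Proof.
move=> xy; rewrite /f /tower_fun -/mu.
have -> : `]-oo, y[%classic = `]-oo, x[ `|` `[x, y[ :> set R.
  apply/seteqP; split=> z /=; rewrite !in_itv/=.
    by have [zx|xz] := ltP z x; [left|move=> zy; right].
  by case=> [zx|/andP[]//]; exact: lt_le_trans xy.
rewrite muU//; last first.
  by apply/seteqP; split => // z [] /=; rewrite !in_itv/= => + /andP[]; lra.
by rewrite fineD ?mu_fin// addrC addKr.
Qed.

Let f_sub_le x y c : x <= y -> (mu `[x, y[ <= c%:E)%E -> f y - f x <= c.
Proof. by move=> xy h; rewrite f_sub// -lee_fin fineK// mu_fin. Qed.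

Lemma tower_fun_nondecreasing : {homo f : x y / x <= y}.
Proof. by move=> x y xy; rewrite -subr_ge0 f_sub// fine_ge0. Qed.

Let lambda_itvco (x y : R) : x <= y -> lambda `[x, y[ = (y - x)%:E.
Proof.
move=> xy; rewrite lebesgue_measure_itv/= lte_fin.
by case: ltgtP xy => // -> _; rewrite subrr.
Qed.


Let lambda_layer_itv m x y : x <= y -> (lambda (A m `&` `[x, y[) <= (y - x)%:E)%E.
Proof.
move=> xy; rewrite -lambda_itvco//; apply: lambda_mono => //.
by apply: measurableI => //; exact: measurable_itv.
Qed.

Let f_sub_le_layers x y c d N : x <= y -> 0 <= c -> 0 <= d ->
  (forall m, (m < N)%N -> (lambda (A m `&` `[x, y[) <= d%:E)%E) ->
  (forall m, (N <= m)%N ->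
    (lambda (A m `&` `[x, y[) <= (2 ^- m.*2 * c)%:E)%E) ->
  f y - f x <= N%:R ^+ 2 * d + 2 * c / 2 ^+ N.
Proof. by move=> xy c0 d0 hd hc; apply: f_sub_le => //; exact: mu_le. Qed.

Let pow2_small (e : R) : 0 < e -> exists N, 2 ^- N < e.
Proof.
move=> e0; exists (Num.trunc e^-1).+1.
rewrite invf_plt ?posrE// (lt_trans (truncnS_gt _))//.
by rewrite -natrX ltr_nat ltn_expl.
Qed.

(** First [N] is fixed to bring the tail [2 / 2^N] below [e / 2]; then a short interval makes
    [N^2 * (v - u)] small. *)
Lemma tower_fun_continuous : continuous f.
Proof.
move=> x; apply/cvgrPdist_lt => e e0.
have [N Ne] : exists N, 2 ^- N < e / 4 by apply: pow2_small; rewrite divr_gt0.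
(* Adding 1 keeps the later divisor positive even when [N = 0]. *)
have N0 : 0 < N%:R ^+ 2 + 1 :> R by rewrite ltr_wpDl// sqr_ge0.
have inc u v : u <= v -> (N%:R ^+ 2 + 1) * (v - u) < e / 2 -> f v - f u < e.
  move=> uv huv.
  have h : f v - f u <= N%:R ^+ 2 * (v - u) + 2 * 1 / 2 ^+ N.
    apply: f_sub_le_layers => //; first by rewrite subr_ge0.
      by move=> m _; exact: lambda_layer_itv.
    by move=> m _; rewrite mulr1; apply: lambda_layer_le; exact: measurable_itv.
  by apply: (le_lt_trans h); lra.
exists (e / 2 / (N%:R ^+ 2 + 1)); first by rewrite /= !divr_gt0.
move=> y /=; rewrite ltr_pdivlMr// mulrC => xy.
have [xley|ylex] := leP x y.
  rewrite distrC ger0_norm ?subr_ge0 ?tower_fun_nondecreasing//.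
  by apply: inc => //; rewrite distrC ger0_norm ?subr_ge0// in xy.
have ylex' := ltW ylex.
rewrite ger0_norm ?subr_ge0 ?tower_fun_nondecreasing//.
by apply: inc => //; rewrite ger0_norm ?subr_ge0// in xy.
Qed.

(* A point missing [V k] also misses all later [V j], whose traces around it
   are thin at every scale. *)
Let lambda_layer_outside k m x d (B : set R) : ~ V k x -> 0 < d ->
  (k < m.*2)%N -> measurable B -> B `<=` `[x - d, x + d] ->
  (lambda (A m `&` B) <= (2 ^- m.*2 * d)%:E)%E.
Proof.
move=> Vx d0 km mB Bd; have [_ _ _ _ thin] := VE.
have Vx' : ~ V m.*2.-1 x.
  by apply: contra_not Vx; apply: V_le; case: (m.*2) km.
have := thin _ _ _ Vx' d0; rewrite (ltn_predK km); apply: le_trans.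
apply: lambda_mono.
- exact: measurableI.
- by apply: measurableI => //; exact: measurable_itv.
- by move=> z [[Vz _] /Bd].
Qed.

(** From [x] outside [V k] increments are at most [C] times the distance: layers up to [k] are
    bounded by length, later ones are thin as seen from [x]. *)
Lemma tower_fun_Linf_sub : Linf f `<=` E.
Proof.
move=> x /LinfP Lx; apply/EV => k; apply: contrapT => Vx.
(* The square comes from the first [k + 1] layers; the summand 2 bounds the geometric tail. *)
pose C : R := k.+1%:R ^+ 2 + 2.
suff h y : `|f x - f y| <= C * `|x - y|.
  have [y _ ny] := Lx (Num.trunc C).+1.
  have := lt_le_trans ny (h y); apply/negP; rewrite -leNgt.
  by rewrite ler_wpM2r// ltW// truncnS_gt.
have [->|xy] := eqVneq x y; first by rewrite !subrr normr0 mulr0.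
pose d := `|x - y|; have d0 : 0 < d by rewrite normr_gt0 subr_eq0.
have inc u v : u <= v -> v - u = d -> `[u, v[ `<=` `[x - d, x + d] ->
    f v - f u <= C * d.
  move=> uv uvd ud.
  have h : f v - f u <= k.+1%:R ^+ 2 * d + 2 * d / 2 ^+ k.+1.
    apply: f_sub_le_layers => //; try exact: ltW.
      by move=> m _; rewrite -uvd; exact: lambda_layer_itv.
    move=> m km; apply: lambda_layer_outside Vx _ _ _ _ => //.
    by rewrite (leq_trans km)// -addnn leq_addr.
  apply: (le_trans h); rewrite /C [leRHS]mulrDl lerD2l ler_pdivrMr//.
  by rewrite ler_peMr ?mulr_ge0 ?(ltW d0)// exprn_ege1// ler1n.
rewrite -/d; have [xley|ylex] := leP x y.
  have dE : d = y - x by rewrite /d distrC ger0_norm ?subr_ge0.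
  rewrite distrC ger0_norm ?subr_ge0 ?tower_fun_nondecreasing//.
  apply: inc => // z; rewrite /= !in_itv/= => /andP[z1 z2].
  by apply/andP; split; lra.
have ylex' := ltW ylex.
have dE : d = x - y by rewrite /d ger0_norm ?subr_ge0.
rewrite ger0_norm ?subr_ge0 ?tower_fun_nondecreasing//.
apply: inc => // z; rewrite /= !in_itv/= => /andP[z1 z2].
by apply/andP; split; lra.
Qed.

Let nearest k x : E x -> exists r a,
  [/\ 0 < r, r < 2 ^- k, ball x r `<=` V k, ~ V k a & `|x - a| = r].
Proof.
move=> /EV Vx; have [_ _ _ /(_ k) lV _] := VE.
have [r [a [r0 rk xV Va xa]]] := exists_nearest_outside (@oV k) lV (Vx k).
by exists r, a; split => //; apply: lt_le_trans rk; lra.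
Qed.

(** Let [a] be nearest to [x] outside [V (2m)], at distance [r]. Seen from [a], [V (2m+1)] takes at
    most half of the segment, so layer [m] fills at least [r / 2] of it and [f] grows by at least
    [m * r / 2]; [m = 2n + 1] makes this exceed [n * r]. *)
Lemma tower_fun_Linf_sup : E `<=` Linf f.
Proof.
move=> x Ex; apply/LinfP => n; pose m := n.*2.+1.
have [r [a [r0 rm xV Va xa]]] := nearest m.*2 Ex.
exists a.
  rewrite xa (lt_trans rm)// ltf_pV2 ?posrE//.
  rewrite -natrX ltr_nat (leq_ltn_trans _ (ltn_expl _ _))//.
  by rewrite /m doubleS ltnS leqW// -!addnn -addnA leq_addr.
(* This covers both positions of [a]; when [a < x] the segment [[a, x[] contains [a], its only point
   outside [V (2m)]. *)
have inc u v : v - u = r -> `[u, v[ `<=` a |` V m.*2 ->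
    `[u, v[ `<=` `[a - r, a + r] -> n%:R * r < f v - f u.
  move=> uvr uvV uva.
  have uv : u <= v by rewrite -subr_ge0 uvr ltW.
  have [_ _ _ _ thin] := VE.
  have mI := @measurable_itv R `[u, v[.
  have mVI : measurable (V m.*2.+1 `&` `[u, v[) by exact: measurableI.
  have mAI : measurable (A m `&` `[u, v[) by exact: measurableI.
  have half : ((r / 2)%:E <= lambda (A m `&` `[u, v[))%E.
    have h1 : (lambda (V m.*2.+1 `&` `[u, v[) <= (2 ^- m.*2.+1 * r)%:E)%E.
      apply: le_trans (thin _ _ _ Va r0); apply: lambda_mono => //.
        by apply: measurableI => //; exact: measurable_itv.
      by apply: setIS.
    have h2 : (lambda `[u, v[ <= lambda (A m `&` `[u, v[) +
        lambda (V m.*2.+1 `&` `[u, v[))%E.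
      have h3 : (lambda `[u, v[ <= lambda ((A m `&` `[u, v[) `|`
          (V m.*2.+1 `&` `[u, v[) `|` [set a]))%E.
        apply: lambda_mono => //.
          by apply: measurableU => //; exact: measurableU.
        move=> z uvz; have [->|Vz] := uvV z uvz; first by right.
        left; have [Vz'|nVz] := pselect (V m.*2.+1 z); first by right.
        by left.
      apply: (le_trans h3).
      have h4 := measureU2 lambda (measurableU _ _ mAI mVI) (measurable_set1 a).
      apply: (le_trans h4).
      have a0 := lebesgue_measure_set1 a.
      rewrite [X in (_ + X <= _)%E](_ : _ = 0%E)// adde0.
      exact: (measureU2 lambda mAI mVI).
    rewrite lambda_itvco// uvr in h2.
    have h5 := le_trans h2 (leeD2l _ h1).
    have p4 : 2 ^- m.*2.+1 <= 2^-1 :> R.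
      rewrite lef_pV2 ?posrE// -[leLHS]expr1.
      by rewrite ler_weXn2l// ler1n.
    have : (r%:E <= lambda (A m `&` `[u, v[) + (r / 2)%:E)%E.
      apply: (le_trans h5); rewrite leeD2l// lee_fin mulrC ler_wpM2l//.
      exact: ltW.
    rewrite -leeBlDr//; apply: le_trans.
    by rewrite -EFinB lee_fin; lra.
  have : ((m%:R * (r / 2))%:E <= mu `[u, v[)%E.
    rewrite /mu /tower_mass (nneseriesD1 (n := m))//.
    apply: (@le_trans _ _ (m%:R%:E * lambda (A m `&` `[u, v[))%E).
      by rewrite EFinM lee_wpmul2l// lee_fin.
    by rewrite leeDl//; exact: nneseries_ge0.
  rewrite -(fineK (mu_fin mI)) -f_sub// lee_fin.
  apply: lt_le_trans; rewrite /m -addn1 -addnn natrD natrD.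
  have : 0 <= n%:R * r by rewrite mulr_ge0// ltW.
  by nra.
rewrite xa; have [xlea|alex] := leP x a.
  have rE : r = a - x by rewrite -xa distrC ger0_norm ?subr_ge0.
  rewrite distrC ger0_norm ?subr_ge0 ?tower_fun_nondecreasing//.
  apply: inc => // z; rewrite /= !in_itv/= => /andP[z1 z2].
    by right; apply: xV; rewrite ball_itv/= in_itv/=; apply/andP; split; lra.
  by apply/andP; split; lra.
have alex' := ltW alex.
have rE : r = x - a by rewrite -xa ger0_norm ?subr_ge0.
rewrite ger0_norm ?subr_ge0 ?tower_fun_nondecreasing//.
apply: inc => // z; rewrite /= !in_itv/= => /andP[z1 z2].
  have [->|za] := eqVneq z a; [by left|right; apply: xV].
  rewrite ball_itv/= in_itv/=; have : a < z by rewrite lt_neqAle eq_sym za.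
  by move=> az; apply/andP; split; lra.
by apply/andP; split; lra.
Qed.

(** Let [a] be nearest to [x] outside [V (2n+1)], at distance [r]. Layers up to [n] miss the ball of
    radius [r] about [x], later ones are thin as seen from [a], so [f] increases by at most
    [2 * 2^-n * r] over [[x - r, x + r]]. *)
Lemma tower_fun_lipf0 x : E x -> lipf f x = 0%E.
Proof.
move=> Ex; apply/eqP; rewrite eq_le lipf_ge0 andbT.
apply/lee_addgt0Pr => c c0; rewrite add0e; apply: lipf_le => e e0.
have [n ne] : exists n, 2 ^- n < Num.min e (c / 2).
  by apply: pow2_small; rewrite lt_min e0 divr_gt0.
have [r [a [r0 rn xV Va xa]]] := nearest n.*2.+1 Ex.
move: ne; rewrite lt_min => /andP[ne nc].
exists r; split => //.
  apply: (lt_trans rn); apply: le_lt_trans ne.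
  by rewrite lef_pV2 ?posrE// ler_weXn2l ?ler1n// -addnn leqW// leq_addr.
have fr : f (x + r) - f (x - r) <= c * r.
  have h : f (x + r) - f (x - r) <= n.+1%:R ^+ 2 * 0 + 2 * (2 * r) / 2 ^+ n.+1.
    apply: f_sub_le_layers => //; [lra|lra| |].
      (* The half-open interval exceeds the open ball only by its left end, a null set. *)
      move=> m mn; rewrite -[leRHS](lebesgue_measure_set1 (x - r)).
      apply: lambda_mono => //.
        by apply: measurableI => //; exact: measurable_itv.
      move=> z [[_ Vz]]; rewrite /= in_itv/= => /andP[z1 z2].
      apply/eqP; rewrite eq_le z1 andbT leNgt; apply/negP => xz.
      apply: Vz; apply: (@V_le _ n.*2.+1); first by rewrite ltnS leq_double.
      by apply: xV; rewrite ball_itv/= in_itv/= xz.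
    (* The window about [a] has half-width [2 * r], since [a] is at distance [r] from [x]. *)
    move=> m nm; apply: lambda_layer_outside Va _ _ _ _.
    - by rewrite mulr_gt0.
    - by rewrite -doubleS leq_double.
    - exact: measurable_itv.
    - move=> z; rewrite /= !in_itv/= => /andP[z1 z2].
      have : - r <= x - a <= r by rewrite -ler_norml xa.
      by move=> /andP[a1 a2]; apply/andP; split; lra.
  apply: (le_trans h); rewrite mulr0 add0r exprS invfM.
  rewrite [leLHS](_ : _ = 2 * 2 ^- n * r); last by field; rewrite expf_neq0.
  by rewrite ler_wpM2r ?ltW//; lra.
(* By monotonicity the one increment over [[x - r, x + r]] dominates every [|f x - f y|] in the
   window. *)
apply: Mf_le => y; rewrite ler_norml => /andP[y1 y2].
rewrite lee_fin ler_pdivrMr//; apply: le_trans fr.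
have f1 : f (x - r) <= f x by apply: tower_fun_nondecreasing; lra.
have f2 : f x <= f (x + r) by apply: tower_fun_nondecreasing; lra.
have f3 : f (x - r) <= f y by apply: tower_fun_nondecreasing; lra.
have f4 : f y <= f (x + r) by apply: tower_fun_nondecreasing; lra.
by rewrite ler_norml; apply/andP; split; lra.
Qed.

End TowerFunction.

Theorem theorem2 (R : realType) :
  (forall f : R -> R, continuous f -> monotone_fun f ->
     Gdelta (Linf f) /\ (lebesgue_measure (Linf f) = 0%E)) /\
  (forall E : set R, Gdelta E -> lebesgue_measure E = 0%E ->
     exists f : R -> R, [/\ continuous f, monotone_fun f,
       Linf f = E, linf f = set0 & forall x, E x -> lipf f x = 0%E]).
Proof.
split=> [f cf mf|E GE E0].
  by split; [exact: Gdelta_Linf|exact: continuous_monotone_null_Linf].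
have [V VE] := exists_thin_tower GE E0.
have LE : Linf (tower_fun V) = E.
  by apply/seteqP; split; [exact: tower_fun_Linf_sub|exact: tower_fun_Linf_sup].
have lE x : E x -> lipf (tower_fun V) x = 0%E by exact: tower_fun_lipf0.
exists (tower_fun V); split => //.
- exact: (tower_fun_continuous VE).
- by left; exact: tower_fun_nondecreasing VE.
(* Since lip is at most Lip, an infinite lip puts [x] in [E], where lip is 0. *)
- apply/seteqP; split => // x lx.
  have Ex : E x.
    by rewrite -LE; apply/eqP; rewrite -leye_eq -[leLHS]lx lipf_le_Lipf.
  by move: lx; rewrite /linf/= lE.
Qed.
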